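(* Let $C$ be a multi-rotationally symmetric planar convex body, with maximal degree $k_C$ and minimal degree $\chi_C\geq 3$. Let $\{k_1=\chi_C,\ldots,k_n=k_C\}$ with $k_1<\ldots<k_n$ be the set of divisors of $k_C$ greater than $1$, and let $P_{k_i}$ be the standard $k_i$-partition associated to $C$, $i=1,\ldots,n$. Then the chain of inequalities $d_M(P_{k_1})\geq\ldots\geq d_M(P_{k_n})$ is a chain of equalities (that is, $d_M(P_{k_1})=\ldots=d_M(P_{k_n})$) if and only if $k_C$ is a product of prime numbers, all of them greater than or equal to $7$.
   Context: A planar convex body is a compact convex subset of $\mathbb{R}^2$ with non-empty interior. For $k\in\mathbb{N}$, $k\geq 2$, a planar convex body $C$ is $k$-rotationally symmetric if there is a point $p\in C$ (the center of symmetry of $C$) such that $C$ is invariant under the rotation of angle $2\pi/k$ about $p$. $C$ is multi-rotationally symmetric if it is $k$-rotationally symmetric for more than one value of $k$. The minimal degree $\chi_C$ is the smallest $k\geq 2$ for which $C$ is $k$-rotationally symmetric; if $C$ is not a circle (i.e. a disk), the maximal degree $k_C$ is the largest such $k$. (A circle has minimal degree $2$.) $C$ is $k$-rotationally symmetric exactly when $k$ is a divisor of $k_C$ greater than $1$. Standard $k$-partition: let $C$ be $k$-rotationally symmetric with center of symmetry $p$. Let $x_1,\ldots,x_k$ be points of $\partial C$ at minimal distance to $p$, symmetrically placed along $\partial C$ (they are the images of one such point under the rotations about $p$ of angles that are multiples of $2\pi/k$). The line segments $\overline{p\,x_i}$ divide $C$ into $k$ connected congruent (closed) subsets $C_1,\ldots,C_k$;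 this decomposition is the standard $k$-partition $P_k$ associated to $C$. The maximum relative diameter of a decomposition $P$ of $C$ into subsets $C_1,\ldots,C_k$ is $d_M(P)=\max\{D(C_i): i=1,\ldots,k\}$, where $D(C_i)=\max\{d(x,y):x,y\in C_i\}$ is the Euclidean diameter. *)

(* Defs.v *)
From HB Require Import structures.
From mathcomp Require Export all_boot all_order all_algebra.
From mathcomp Require Export all_classical all_reals all_analysis.
Export numFieldNormedType.Exports.

Set Implicit Arguments.
Unset Strict Implicit.
Unset Printing Implicit Defensive.

Import Order.TTheory GRing.Theory Num.Theory.

Local Open Scope classical_set_scope.
Local Open Scope ring_scope.

(* The plane is 'rV[R]_2.  The library norm on it is the sup norm: it induces
   the usual topology, but Euclidean distances have to be defined separately. *)

Definition edist (R : realType) (x y : 'rV[R]_2) : R :=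
  Num.sqrt (\sum_(j < 2) (x 0 j - y 0 j) ^+ 2).

(* The maximum of the distances when S is compact and nonempty. *)
Definition diameter (R : realType) (S : set 'rV[R]_2) : R :=
  sup [set edist z.1 z.2 | z in S `*` S].

Definition boundary (R : realType) (C : set 'rV[R]_2) : set 'rV[R]_2 :=
  closure C `\` interior C.

Definition segment (R : realType) (a b : 'rV[R]_2) : set 'rV[R]_2 :=
  [set a + t *: (b - a) | t in `[0, 1]].

Definition rotation (R : realType) (p : 'rV[R]_2) (theta : R) (v : 'rV[R]_2) :
    'rV[R]_2 :=
  let w := v - p in
  p + \row_(j < 2) (if j == 0 then cos theta * w 0 0 - sin theta * w 0 1
                    else sin theta * w 0 0 + cos theta * w 0 1).

Definition planar_convex_body (R : realType) (C : set 'rV[R]_2) : Prop :=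
  [/\ compact C, convex_set C & interior C !=set0].

Definition symmetry_center (R : realType) (k : nat) (C : set 'rV[R]_2)
    (p : 'rV[R]_2) : Prop :=
  C p /\ rotation p (2 * pi / k%:R) @` C = C.

Definition rotationally_symmetric (R : realType) (k : nat)
    (C : set 'rV[R]_2) : Prop :=
  (2 <= k)%N /\ exists p, symmetry_center k C p.

Definition multi_rotationally_symmetric (R : realType) (C : set 'rV[R]_2) :
    Prop :=
  exists k l : nat,
    [/\ k <> l, rotationally_symmetric k C & rotationally_symmetric l C].

Definition minimal_degree (R : realType) (C : set 'rV[R]_2) (chi : nat) :
    Prop :=
  rotationally_symmetric chi C /\
  forall k : nat, rotationally_symmetric k C -> (chi <= k)%N.

Definition maximal_degree (R : realType) (C : set 'rV[R]_2) (kC : nat) :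
    Prop :=
  rotationally_symmetric kC C /\
  forall k : nat, rotationally_symmetric k C -> (k <= kC)%N.

Definition nearest_boundary_point (R : realType) (C : set 'rV[R]_2)
    (p x : 'rV[R]_2) : Prop :=
  boundary C x /\ forall y, boundary C y -> edist p x <= edist p y.

(* The subsets into which the k segments from p to the rotated copies of x
   divide C: the closures of the connected components of what remains of C
   once the segments are removed. *)
Definition pieces (R : realType) (k : nat) (C : set 'rV[R]_2)
    (p x : 'rV[R]_2) : set (set 'rV[R]_2) :=
  let A := C `\` \bigcup_(i in `I_k)
                   segment p (rotation p (2 * pi * i%:R / k%:R) x) in
  [set closure (connected_component A y) | y in A].

(* The nearest boundary point x need not be unique, hence a predicate. *)
Definition standard_partition (R : realType) (k : nat) (C : set 'rV[R]_2)
    (P : set (set 'rV[R]_2)) : Prop :=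
  exists p x, [/\ symmetry_center k C p, nearest_boundary_point C p x
                & P = pieces k C p x].

(* A maximum, as a standard partition is finite. *)
Definition max_rel_diameter (R : realType) (P : set (set 'rV[R]_2)) : R :=
  sup [set diameter S | S in P].

(* Main.v *)
Require Import Defs.
From mathcomp Require Import ring lra zify.
Import Order.TTheory GRing.Theory Num.Theory.
Local Open Scope classical_set_scope.
Local Open Scope ring_scope.

Set Implicit Arguments.
Unset Strict Implicit.
Unset Printing Implicit Defensive.

(** Let r and F be the smallest and the largest distance from the center p to a
    boundary point, and let u be the vector from p to a nearest boundary point.

    For k >= 3 the pieces of the standard k-partition are the intersections of C
    with the k closed sectors between consecutive rotated copies, called spokes,
    of u [piecesE]. The part of C strictly inside a sector is convex, hence
    connected; it is open and closed in the slit body, because the whole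
    part in C of the two bounding rays has been removed: beyond its foot a ray
    leaves C, as C has a supporting line orthogonal to the spoke there
    [nearest_support].

    Each piece contains p, so its diameter is at least the distance from p to
    any of its points. If k >= 6 its opening is at most a sixth of a turn and
    two points of the piece are never farther apart than the farther of them is
    from p, so the maximum relative diameter is exactly F
    [max_rel_diameter_farthest]. All the partitions have the same center
    [center_unique], hence they all have the same maximum relative diameter when
    all prime factors of the maximal degree, and with them all degrees, are at
    least 7.

    If k is 3, 4 or 5, the feet of two consecutive spokes show that the square
    of the maximum relative diameter is at least (2 - 2 cos (2 pi / k)) r^2
    [chord_le_max_rel_diameter], which is more than 4 r^2 / 3. On the other
    hand, a body with an l-fold symmetry lies in the regular l-gon formed by the
    supporting lines at the feet of the l spokes, so
    F^2 <= 2 r^2 / (1 + cos (2 pi / l)) [sqdist_le], which is at most 4 r^2 / 3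
    as soon as l >= 6. So a degree k <= 5 and a degree l >= 6 cannot have the
    same maximum relative diameter [max_rel_diameter_lt].

    Finally, every degree divides the maximal one [degree_dvd], since the least
    common multiple of two degrees is a degree. As C has several degrees, the
    maximal degree is not prime; if it has a prime factor less than 7, then that
    factor is 3 or 5, degree 2 being excluded, and the maximal degree is at
    least 6, so that the inequality above is strict somewhere in the chain. *)

(** * Vectors of the plane *)

Section Vectors.
Variable R : realType.
Implicit Types (a b u v w : 'rV[R]_2) (s t : R).

Definition dot a b : R := a 0 0 * b 0 0 + a 0 1 * b 0 1.

Definition cross a b : R := a 0 0 * b 0 1 - a 0 1 * b 0 0.

Definition rot t w : 'rV[R]_2 :=
  \row_(j < 2) (if j == 0 then cos t * w 0 0 - sin t * w 0 1
                else sin t * w 0 0 + cos t * w 0 1).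

Lemma rotationE p t v : rotation p t v = p + rot t (v - p).
Proof. by []. Qed.

Lemma rotationB p t v : rotation p t v - p = rot t (v - p).
Proof. by rewrite rotationE addrAC subrr add0r. Qed.

Lemma row2P a b : a 0 0 = b 0 0 -> a 0 1 = b 0 1 -> a = b.
Proof.
move=> h0 h1; apply/rowP => j.
by case: j => -[|[|//]] hj;
  [rewrite (_ : Ordinal hj = 0)|rewrite (_ : Ordinal hj = 1)];
  rewrite ?h0 ?h1//; apply/val_inj.
Qed.

Lemma rot0E t w : rot t w 0 0 = cos t * w 0 0 - sin t * w 0 1.
Proof. by rewrite mxE. Qed.

Lemma rot1E t w : rot t w 0 1 = sin t * w 0 0 + cos t * w 0 1.
Proof. by rewrite mxE. Qed.

Definition coordE := (rot0E, rot1E, mxE).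

Lemma edistE a b : edist a b = Num.sqrt (dot (a - b) (a - b)).
Proof.
congr Num.sqrt; rewrite big_ord_recl big_ord1 /dot !mxE.
by rewrite (_ : lift ord0 ord0 = 1) ?expr2//; apply/val_inj.
Qed.

Lemma dotC a b : dot a b = dot b a. Proof. by rewrite /dot; ring. Qed.

Lemma dotDl a b v : dot (a + b) v = dot a v + dot b v.
Proof. by rewrite /dot !coordE; ring. Qed.

Lemma dotBB a b : dot (a - b) (a - b) = dot a a + dot b b - 2 * dot a b.
Proof. by rewrite /dot !coordE; ring. Qed.

Lemma dot_comb s t a b v : dot (s *: a + t *: b) v = s * dot a v + t * dot b v.
Proof. by rewrite /dot !coordE; ring. Qed.

Lemma dotZl s a v : dot (s *: a) v = s * dot a v.
Proof. by rewrite /dot !coordE; ring. Qed.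

Lemma dot_ge0 a : 0 <= dot a a.
Proof. by rewrite /dot; nra. Qed.

Lemma dot_eq0 a : dot a a = 0 -> a = 0.
Proof.
rewrite /dot => h; have ha : a 0 0 ^+ 2 = 0 by nra.
have hb : a 0 1 ^+ 2 = 0 by nra.
by apply: row2P; rewrite mxE; apply/eqP; rewrite -sqrf_eq0 ?ha ?hb.
Qed.

Lemma dot_gt0 a : a != 0 -> 0 < dot a a.
Proof.
move=> a0; rewrite lt_neqAle dot_ge0 andbT eq_sym.
by apply: contra_neq a0; exact: dot_eq0.
Qed.

Lemma crossDl a b v : cross (a + b) v = cross a v + cross b v.
Proof. by rewrite /cross !coordE; ring. Qed.

Lemma crossZl s a v : cross (s *: a) v = s * cross a v.
Proof. by rewrite /cross !coordE; ring. Qed.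

Lemma crossC a b : cross a b = - cross b a.
Proof. by rewrite /cross; ring. Qed.

Lemma cross_gt0C a b : (0 < cross a b) = (cross b a < 0).
Proof. by rewrite crossC oppr_gt0. Qed.

Lemma cross_ge0C a b : (0 <= cross a b) = (cross b a <= 0).
Proof. by rewrite crossC oppr_ge0. Qed.

Lemma crossDr a b v : cross v (a + b) = cross v a + cross v b.
Proof. by rewrite /cross !coordE; ring. Qed.

Lemma crossZr s a v : cross v (s *: a) = s * cross v a.
Proof. by rewrite /cross !coordE; ring. Qed.

Lemma crossvv a : cross a a = 0.
Proof. by rewrite /cross; ring. Qed.

(** Cramer's rule: the coordinates of w in the frame (u, v). *)
Lemma cramer u v w : cross u v != 0 ->
  w = (cross w v / cross u v) *: u + (cross u w / cross u v) *: v.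
Proof.
rewrite /cross => h; by apply: row2P; rewrite !coordE; field.
Qed.

Lemma cone_coord u v w : 0 < cross u v -> 0 <= cross u w -> 0 <= cross w v ->
  exists s t, [/\ w = s *: u + t *: v, 0 <= s & 0 <= t].
Proof.
move=> c0 w1 w2; exists (cross w v / cross u v), (cross u w / cross u v).
by split; [exact/cramer/lt0r_neq0|exact/divr_ge0/ltW|exact/divr_ge0/ltW].
Qed.

Lemma rotD t a b : rot t (a + b) = rot t a + rot t b.
Proof. by apply: row2P; rewrite !coordE; ring. Qed.

Lemma rotZ t s a : rot t (s *: a) = s *: rot t a.
Proof. by apply: row2P; rewrite !coordE; ring. Qed.

Lemma rot0 w : rot 0 w = w.
Proof. by apply: row2P; rewrite !coordE cos0 sin0; ring. Qed.

Lemma rot_rot s t w : rot s (rot t w) = rot (s + t) w.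
Proof. by apply: row2P; rewrite !coordE cosD sinD; ring. Qed.

Lemma rotD2pi t w : rot (t + 2 * pi) w = rot t w.
Proof. by apply: row2P; rewrite !coordE mulr_natl cosD2pi sinD2pi. Qed.

Lemma dot_rot_rot s t u : dot (rot s u) (rot t u) = cos (t - s) * dot u u.
Proof. by rewrite cosB /dot !coordE; ring. Qed.

Lemma cross_rot_rot s t u : cross (rot s u) (rot t u) = sin (t - s) * dot u u.
Proof. by rewrite sinB /cross /dot !coordE; ring. Qed.

Lemma dot_rot t a b : dot (rot t a) (rot t b) = dot a b.
Proof.
have := cos2Dsin2 t; rewrite /dot !coordE => h.
rewrite -[RHS]mul1r -h; ring.
Qed.

Lemma cross_sum n (F : 'I_n -> 'rV[R]_2) v :
  cross (\sum_(i < n) F i) v = \sum_(i < n) cross (F i) v.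
Proof.
elim/big_ind2: _ => //; first by rewrite /cross !mxE; ring.
by move=> ? ? ? ? <- <-; rewrite crossDl.
Qed.

(** The rotation moves w by a distance |w| sqrt (2 - 2 cos t). *)
Lemma rot_fix t w : cos t < 1 -> rot t w = w -> w = 0.
Proof.
move=> ct h; apply: dot_eq0.
have : dot (rot 0 w) (rot t w) = dot w w by rewrite h rot0.
rewrite dot_rot_rot subr0 => e; have := dot_ge0 w; nra.
Qed.

End Vectors.

(** * Regular subdivisions of the full turn *)

Section Turns.
Variable R : realType.
Implicit Types (u w : 'rV[R]_2) (k i j : nat).

Definition turn k i : R := 2 * pi * i%:R / k%:R.

Definition spoke k u i : 'rV[R]_2 := rot (turn k i) u.

Lemma turn0 k : turn k 0 = 0. Proof. by rewrite /turn mulr0 mul0r. Qed.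

Lemma turn1 k : turn k 1 = 2 * pi / k%:R. Proof. by rewrite /turn mulr1. Qed.

Lemma turnD k i j : turn k (i + j) = turn k i + turn k j.
Proof. by rewrite /turn natrD; ring. Qed.

Lemma turnS k i : turn k i.+1 = turn k 1 + turn k i.
Proof. by rewrite -turnD. Qed.

Lemma turn_full k : (0 < k)%N -> turn k k = 2 * pi.
Proof. by move=> k0; rewrite /turn mulfK// pnatr_eq0 -lt0n. Qed.

Lemma spoke0 k u : spoke k u 0 = u. Proof. by rewrite /spoke turn0 rot0. Qed.

Lemma spokeDk k u i : (0 < k)%N -> spoke k u (i + k) = spoke k u i.
Proof. by move=> k0; rewrite /spoke turnD turn_full// rotD2pi. Qed.

Lemma spoke_mod k u i : (0 < k)%N -> spoke k u i = spoke k u (i %% k).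
Proof.
move=> k0; rewrite {1}(divn_eq i k) addnC.
by elim: (i %/ k)%N => [|q IH]; rewrite ?addn0// mulSn addnCA addnC spokeDk.
Qed.

Lemma spokeS k u i : spoke k u i.+1 = rot (turn k 1) (spoke k u i).
Proof. by rewrite /spoke rot_rot -turnS. Qed.

Lemma dot_spoke k u i : dot (spoke k u i) (spoke k u i) = dot u u.
Proof. exact: dot_rot. Qed.

Lemma turn_gt0 k i : (0 < k)%N -> (0 < i)%N -> 0 < turn k i :> R.
Proof.
by move=> k0 i0; rewrite /turn divr_gt0// ?mulr_gt0// ?pi_gt0 ?ltr0n.
Qed.

Lemma turn_le_pi k i : (0 < k)%N -> ((turn k i <= pi :> R) = (2 * i <= k)%N).
Proof.
move=> k0; rewrite /turn ler_pdivrMr ?ltr0n// -[RHS](ler_nat R) natrM.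
by rewrite -mulrA mulrCA ler_pM2l// pi_gt0.
Qed.

Lemma turn_lt_pi k i : (0 < k)%N -> ((turn k i < pi :> R) = (2 * i < k)%N).
Proof.
move=> k0; rewrite /turn ltr_pdivrMr ?ltr0n// -[RHS](ltr_nat R) natrM.
by rewrite -mulrA mulrCA ltr_pM2l// pi_gt0.
Qed.

Lemma cos_turn_lt1 k : (1 < k)%N -> cos (turn k 1) < 1 :> R.
Proof.
move=> k1; have k0 : (0 < k)%N by apply: leq_trans k1.
rewrite -(cos0 R) ltr_cos ?turn_gt0// in_itv/= ?lexx ?pi_ge0//.
by rewrite ltW ?turn_gt0// turn_le_pi.
Qed.

Lemma sin_turn_gt0 k : (2 < k)%N -> 0 < sin (turn k 1) :> R.
Proof.
move=> k1; have k0 : (0 < k)%N by apply: leq_trans k1.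
by apply: sin_gt0_pi; rewrite turn_gt0// turn_lt_pi.
Qed.

Lemma sin_turn_ge0 k i : (0 < k)%N -> (2 * i <= k)%N -> 0 <= sin (turn k i).
Proof.
move=> k0 ik; apply: sin_ge0_pi; rewrite turn_le_pi// ik andbT.
by rewrite /turn divr_ge0// ?mulr_ge0// ?pi_ge0 ?ler0n.
Qed.

Lemma sin_turn_le0 k i : (0 < k)%N -> (i <= k)%N -> (k <= 2 * i)%N ->
  sin (turn k i) <= 0.
Proof.
move=> k0 ik ki; have -> : turn k i = - turn k (k - i) + pi *+ 2.
  have e : turn k i + turn k (k - i) = 2 * pi by rewrite -turnD subnKC// turn_full.
  by rewrite -[pi *+ 2]mulr_natl -e; ring.
rewrite sinD2pi sinN oppr_le0 sin_turn_ge0//; lia.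
Qed.

(** No spoke lies strictly between two consecutive ones: otherwise the residues
    modulo k of j - i and i + 1 - j would both lie strictly between 0 and k / 2,
    and two positive integers with a sum below k would add up to 1 modulo k. *)
Lemma spoke_gap k i j : (i < k)%N -> (j < k)%N ->
  0 < sin (turn k j - turn k i) -> sin (turn k i.+1 - turn k j) <= 0.
Proof.
move=> ik jk; have k0 : (0 < k)%N by apply: leq_ltn_trans ik.
have [ji|ij] := leqP j i.
  have -> : turn k j - turn k i = - turn k (i - j).
    by rewrite -{1}(subnK ji) turnD; ring.
  have -> : turn k i.+1 - turn k j = turn k (i - j).+1.
    by rewrite -{1}(subnK ji) -addSn turnD addrK.
  rewrite sinN oppr_gt0 => h; apply: sin_turn_le0 => //; first lia.
  by have [|] := leqP (2 * (i - j)) k => [/(sin_turn_ge0 k0)|]; [rewrite leNgt h|lia].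
have -> : turn k j - turn k i = turn k (j - i).
  by rewrite -{1}(subnK (ltnW ij)) turnD addrK.
have -> : turn k i.+1 - turn k j = - turn k (j - i.+1).
  by rewrite -{1}(subnK ij) turnD; ring.
rewrite sinN oppr_le0 => h; apply: sin_turn_ge0 => //.
have [|] := leqP k (2 * (j - i)) => [hk|]; last lia.
suff : sin (turn k (j - i)) <= 0 by rewrite leNgt h.
by apply: sin_turn_le0 => //; lia.
Qed.

(** Rotating by one step permutes the spokes, so it fixes their sum. *)
Lemma sum_spoke k u : (1 < k)%N -> \sum_(i < k) spoke k u i = 0.
Proof.
case: k => // k k1; apply: (rot_fix (cos_turn_lt1 k1)).
rewrite -[LHS]/(rot _ _).
have -> : rot (turn k.+1 1) (\sum_(i < k.+1) spoke k.+1 u i)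
    = \sum_(i < k.+1) spoke k.+1 u i.+1.
  elim/big_ind2 : _ => //; first by rewrite -[X in rot _ X](scale0r 0) rotZ scale0r.
  - by move=> ? ? ? ? <- <-; rewrite rotD.
  - by move=> i _; rewrite spokeS.
rewrite big_ord_recr/= [RHS]big_ord_recl/= addrC; congr (_ + _).
by rewrite -[in LHS](add0n k.+1) spokeDk.
Qed.

(** The sign of w relative to the successive spokes cannot be constant, because
    the spokes add up to zero; w lies where it changes. *)
Lemma sector_cover k u w : (1 < k)%N -> exists i,
  [/\ (i < k)%N, 0 <= cross (spoke k u i) w & 0 <= cross w (spoke k u i.+1)].
Proof.
move=> k1; have k0 : (0 < k)%N by apply: leq_trans k1.
pose c i := cross (spoke k u i) w.
have cS : \sum_(i < k) c i = 0.
  by rewrite -cross_sum sum_spoke// /cross !mxE !mul0r subr0.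
have cper i : c (i + k)%N = c i by rewrite /c spokeDk.
have cmod i : c i = c (i %% k)%N by rewrite /c -spoke_mod.
apply: contrapT => H.
have step i : 0 <= c i -> 0 < c i.+1.
  move=> ci; rewrite ltNge; apply/negP => ci1; apply: H; exists (i %% k)%N.
  split; [exact: ltn_pmod|by move: ci; rewrite cmod|].
  have e : c (i %% k).+1 = c i.+1 by rewrite [LHS]cmod [RHS]cmod -addn1 modnDml addn1.
  by rewrite crossC oppr_ge0 -/(c _) e.
have [i0 ci0] : exists i0 : 'I_k, 0 <= c i0.
  apply: contrapT => /forallNP h.
  have neg (i : 'I_k) : c i < 0 by rewrite ltNge; apply/negP/(h i).
  move: cS; rewrite (bigD1 (Ordinal k0))//=; have := neg (Ordinal k0).
  have : \sum_(i < k | i != Ordinal k0) c i <= 0.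
    by apply: sumr_le0 => i _; exact/ltW/neg.
  lra.
have pos n : 0 < c (i0 + n.+1)%N.
  elim: n => [|n IH]; first by rewrite addn1; exact: step.
  by rewrite addnS; apply/step/ltW.
have cpos j : 0 < c j.
  (* The index j + k lies beyond i0 and gives the same sign as j. *)
  have := pos (j + (k - i0).-1)%N.
  by rewrite -addnS prednK ?subn_gt0// addnCA subnKC 1?ltnW// cper.
move: cS; rewrite (bigD1 (Ordinal k0))//=; have := cpos (Ordinal k0).
have : 0 <= \sum_(i < k | i != Ordinal k0) c i by apply: sumr_ge0 => i _; exact/ltW.
lra.
Qed.

End Turns.

(** * Segments and convexity *)

Section Segments.
Variable R : realType.
Implicit Types (a b p u v z : 'rV[R]_2) (t : R) (C : set 'rV[R]_2).

Lemma continuous_segment a b : continuous (fun t : R => a + t *: (b - a)).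
Proof.
by move=> t; apply: cvgD; [exact: cvg_cst|apply: cvgZ; [exact: cvg_id|exact: cvg_cst]].
Qed.

Lemma segment_left a b : segment a b a.
Proof. by exists 0; rewrite ?scale0r ?addr0//= in_itv/= lexx ler01. Qed.

Lemma segment_right a b : segment a b b.
Proof. by exists 1; rewrite ?scale1r ?subrKC//= in_itv/= lexx ler01. Qed.

Lemma segment_is_connected a b : connected (segment a b).
Proof.
apply: connected_continuous_connected; first exact: segment_connected.
exact/continuous_subspaceT/continuous_segment.
Qed.

Lemma continuous_translation b : continuous (fun z : 'rV[R]_2 => z - b).
Proof.
move=> z; apply: (@continuousB R 'rV[R]_2 'rV[R]_2 id (fun=> b)).
  by move=> ?.
exact: cst_continuous.
Qed.

Lemma closure_segment_end C z m :
  (forall t, 0 < t -> t <= 1 -> C (z + t *: (m - z))) -> closure C z.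
Proof.
move=> h B Bz.
have := @continuous_segment z m 0; rewrite /continuous_at scale0r addr0.
move=> /(_ _ Bz) /nbhs_ballP[e /= e0 he]; pose t := Num.min (e / 2) 1.
have t0 : 0 < t by rewrite /t lt_min ltr01 divr_gt0.
exists (z + t *: (m - z)); split; first by apply: h => //; rewrite /t ge_min lexx orbT.
apply: he; rewrite /ball/= sub0r normrN gtr0_norm//.
by rewrite /t gt_min; apply/orP; left; rewrite ltr_pdivrMr// ltr_pMr// ltr1n.
Qed.

Lemma convex_segment C a b t :
  convex_set C -> C a -> C b -> 0 <= t -> t <= 1 -> C (a + t *: (b - a)).
Proof.
move=> cC Ca Cb t0 t1; have := cC b a (Itv01 t0 t1); rewrite !inE => /(_ Cb Ca).
by congr C; apply: row2P; rewrite !mxE /= /unstable.onem; ring.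
Qed.

(** The dilation of centre b that takes the given point to a pulls back a
    neighbourhood of a in C to a neighbourhood in C. *)
Lemma interior_segment C a b t : convex_set C -> interior C a -> C b ->
  0 <= t -> t < 1 -> interior C (a + t *: (b - a)).
Proof.
move=> cC Ca Cb t0 t1; have s0 : 1 - t != 0 by rewrite subr_eq0 gt_eqF.
pose f z := b + (1 - t)^-1 *: (z - b).
have fC : continuous f.
  rewrite /f => z; apply: (@continuousD R 'rV[R]_2 'rV[R]_2
    (fun=> b) (fun z => (1 - t)^-1 *: (z - b))); first exact: cst_continuous.
  by apply: (@continuousZ R 'rV[R]_2 'rV[R]_2 (fun=> (1 - t)^-1));
    [exact: cst_continuous|exact: continuous_translation].
have fa : f (a + t *: (b - a)) = a.
  by apply: row2P; rewrite !mxE; field.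
rewrite /interior; have := fC (a + t *: (b - a)); rewrite /continuous_at fa.
move=> /(_ _ Ca); apply: (@filterS _ _ (@nbhs_filter 'rV[R]_2 _)) => z /= Cfz.
have -> : z = b + (1 - t) *: (f z - b).
  by apply: row2P; rewrite !mxE; field.
by apply: convex_segment => //; lra.
Qed.

Lemma convex_average C n (F : nat -> 'rV[R]_2) : convex_set C ->
  (forall i, C (F i)) -> C (n.+1%:R^-1 *: \sum_(i < n.+1) F i).
Proof.
move=> cC CF; elim: n => [|n IH]; first by rewrite big_ord1 invr1 scale1r.
rewrite big_ord_recr/=; set S := \sum_(i < n.+1) _ in IH *.
have n0 : 0 < n.+1%:R :> R by rewrite ltr0n.
have -> : n.+2%:R^-1 *: (S + F n.+1)
    = n.+1%:R^-1 *: S + n.+2%:R^-1 *: (F n.+1 - n.+1%:R^-1 *: S).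
  rewrite -(natr1 n.+1); move: (n.+1%:R) n0 => m m0.
  by apply: row2P; rewrite !mxE; field; apply/andP; split; lra.
by apply: convex_segment => //; rewrite ?invr_ge0 ?ler0n// invf_le1 ?ltr0n// ler1n.
Qed.

Lemma continuous_cross p v : continuous (fun z => cross (z - p) v).
Proof.
move=> z; apply: (@continuous_comp _ _ _ (fun z => z - p) (fun a => cross a v)).
  exact: continuous_translation.
apply: (@continuousB R R^o _ (fun a : 'rV[R]_2 => a 0 0 * v 0 1)
                             (fun a : 'rV[R]_2 => a 0 1 * v 0 0)).
  apply: (@continuousM R _ (fun a : 'rV[R]_2 => a 0 0)); last exact: cst_continuous.
  exact: coord_continuous.
apply: (@continuousM R _ (fun a : 'rV[R]_2 => a 0 1)); last exact: cst_continuous.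
exact: coord_continuous.
Qed.

Lemma continuous_sqdist p : continuous (fun z => dot (z - p) (z - p)).
Proof.
move=> z; apply: (@continuous_comp _ _ _ (fun z => z - p) (fun a => dot a a)).
  exact: continuous_translation.
apply: (@continuousD R R^o _ (fun a : 'rV[R]_2 => a 0 0 * a 0 0)
                             (fun a : 'rV[R]_2 => a 0 1 * a 0 1)).
  by apply: (@continuousM R _ (fun a : 'rV[R]_2 => a 0 0)); exact: coord_continuous.
by apply: (@continuousM R _ (fun a : 'rV[R]_2 => a 0 1)); exact: coord_continuous.
Qed.

Lemma open_disc p (r : R) : open [set z | dot (z - p) (z - p) < r].
Proof.
apply: (@open_comp _ _ (fun z => dot (z - p) (z - p)) [set x | x < r]).
  by move=> z _; exact: continuous_sqdist.
exact: open_lt.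
Qed.

Lemma compact_sqdist_bounded C p : compact C ->
  exists M, forall z, C z -> dot (z - p) (z - p) <= M.
Proof.
move=> cC.
have : compact ((fun z => dot (z - p) (z - p)) @` C).
  by apply: continuous_compact => //; exact/continuous_subspaceT/continuous_sqdist.
move=> /compact_bounded[M [_ hM]]; exists (M + 1) => z Cz.
have /= := hM (M + 1) _ (dot (z - p) (z - p)).
rewrite ltrDl ltr01 => /(_ isT (ex_intro2 _ _ z Cz erefl)).
exact: le_trans (ler_norm _).
Qed.

End Segments.

(** * Centers of symmetry *)

Section Symmetry.
Variable R : realType.
Implicit Types (a b p q u v x z : 'rV[R]_2) (t : R) (C : set 'rV[R]_2) (k i : nat).

Lemma symmetry_mem C p k i z : symmetry_center k C p -> C z ->
  C (p + rot (turn R k i) (z - p)).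
Proof.
move=> [_ hC] Cz; elim: i => [|i IH]; first by rewrite turn0 rot0 subrKC.
rewrite turnS -rot_rot turn1 -hC; exists (p + rot (turn R k i) (z - p)) => //.
by rewrite rotationE addrAC subrr add0r.
Qed.

Lemma symmetry_preimage C p k i z : symmetry_center k C p -> C z ->
  exists2 z', C z' & z - p = rot (turn R k i) (z' - p).
Proof.
move=> [_ hC]; elim: i z => [|i IH] z Cz; first by exists z; rewrite ?turn0 ?rot0.
have [z1 Cz1 <-] : (rotation p (2 * pi / k%:R) @` C) z by rewrite hC.
have [z' Cz' e] := IH _ Cz1; exists z' => //.
by rewrite rotationB e rot_rot -turn1 -turnS.
Qed.

(** The images of an interior point z under the rotations average to p, so p is
    a proper convex combination of z and of the average of the other images. *)
Lemma center_interior C p k : (1 < k)%N -> planar_convex_body C ->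
  symmetry_center k C p -> interior C p.
Proof.
case: k => [|[|k]]// _ [_ cC [z iz]] hp; have Cz := interior_subset iz.
pose F i := p + rot (turn R k.+2 i.+1) (z - p).
have CF i : C (F i) by exact: symmetry_mem.
have n0 : 0 < k.+1%:R :> R by rewrite ltr0n.
pose q := k.+1%:R^-1 *: \sum_(i < k.+1) F i.
have -> : p = z + (k.+1%:R / k.+2%:R) *: (q - z).
  have : \sum_(i < k.+2) spoke k.+2 (z - p) i = 0 by exact: sum_spoke.
  rewrite big_ord_recl/= spoke0.
  have eF : \sum_(i < k.+1) F i =
      k.+1%:R *: p + \sum_(i < k.+1) spoke k.+2 (z - p) (bump 0 i).
    by rewrite big_split/= sumr_const card_ord scaler_nat.
  rewrite /q eF; move: (\sum_(i < k.+1) spoke _ _ _) => S.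
  rewrite addrC => /(canRL (addrK _)) ->; rewrite -(natr1 k.+1).
  move: (k.+1%:R) n0 => m m0.
  by apply: row2P; rewrite !mxE; field; rewrite !gt_eqF ?addr_gt0.
apply: interior_segment => //; first exact: convex_average.
by rewrite ltr_pdivrMr ?ltr0n// mul1r ltr_nat.
Qed.

(** A translation by v would raise by |v|^2 the supremum over C of the linear
    form z |-> z . v. *)
Lemma compact_no_translation C v : compact C -> C !=set0 ->
  (forall z, C z -> C (z + v)) -> v = 0.
Proof.
move=> cC [z0 Cz0] hv; have [M hM] := compact_sqdist_bounded 0 cC.
apply: dot_eq0; apply/eqP; rewrite eq_le dot_ge0 andbT.
pose S := (fun z => dot z v) @` C.
have ubS : has_ubound S.
  exists (M + dot v v) => _ [z Cz <-]; have := hM _ Cz; rewrite subr0.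
  have := dot_ge0 (z - v); have := dot_ge0 z; have := dot_ge0 v.
  by rewrite dotBB; lra.
have : sup S <= sup S - dot v v.
  apply: ge_sup; first by exists (dot z0 v); exists z0.
  move=> _ [z Cz <-]; rewrite lerBrDr -dotDl.
  by apply: ub_le_sup => //; exists (z + v) => //; exact: hv.
lra.
Qed.

(** Rotations about two centers commute up to a translation, which maps the body
    to itself and is nonzero when the centers differ. *)
Lemma center_unique C p q k l : (1 < k)%N -> (1 < l)%N -> compact C ->
  symmetry_center k C p -> symmetry_center l C q -> p = q.
Proof.
move=> k1 l1 cC hp hq; pose A := rot (turn R k 1); pose B := rot (turn R l 1).
pose e := (p - q) - B (p - q); pose v := e - A e.
have hv z : C z -> C (z + v).
  move=> Cz; have [z1 Cz1 h1] := symmetry_preimage 1 hq Cz.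
  have [z2 Cz2 h2] := symmetry_preimage 1 hp Cz1.
  have -> : z + v = p + A (q + B (z2 - q) - p).
    have -> : z = q + B (p + A (z2 - p) - q).
      by rewrite /A -h2 subrKC /B -h1 subrKC.
    by apply: row2P; rewrite /v /e /A /B !coordE; ring.
  exact: (symmetry_mem 1 hp (symmetry_mem 1 hq Cz2)).
have v0 : v = 0.
  by apply: (compact_no_translation cC _ hv); exists p; case: hp.
have e0 : e = 0.
  by apply: (rot_fix (cos_turn_lt1 R k1)); apply/esym/eqP; rewrite -subr_eq0 -/(A e) -/v v0.
apply/eqP; rewrite -subr_eq0; apply/eqP.
by apply: (rot_fix (cos_turn_lt1 R l1)); apply/esym/eqP; rewrite -subr_eq0 -/(B _) -/e e0.
Qed.

End Symmetry.

(** * The nearest boundary points *)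

Section Nearest.
Variable R : realType.
Implicit Types (a b p q u v x z : 'rV[R]_2) (t : R) (C : set 'rV[R]_2) (k i : nat).

Lemma edist_le a b c d : (edist a b <= edist c d :> R) =
  (dot (b - a) (b - a) <= dot (d - c) (d - c)).
Proof.
rewrite !edistE ler_sqrt ?dot_ge0//.
by congr (_ <= _); rewrite /dot !mxE; ring.
Qed.

Variables (C : set 'rV[R]_2) (p x : 'rV[R]_2).
Hypotheses (clC : closed C) (cC : convex_set C) (ip : interior C p).
Hypothesis hx : nearest_boundary_point C p x.

Lemma nearest_mem : C x.
Proof. by have [[+ _] _] := hx; rewrite -(closure_id C).1. Qed.

Lemma nearest_neq : x - p != 0.
Proof.
apply/negP; rewrite subr_eq0 => /eqP xp.
by have [[_ +] _] := hx; apply; rewrite xp.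
Qed.

(** Otherwise the segment from p to z would cross the boundary nearer to p
    than x. *)
Lemma disc_sub z : dot (z - p) (z - p) < dot (x - p) (x - p) -> C z.
Proof.
move=> zx; apply: contrapT => nCz.
have : segment p z `&` interior C = segment p z.
  apply: segment_is_connected.
  - by exists p; split => //; exact: segment_left.
  - by exists (interior C) => //; exact: open_interior.
  exists C => //; apply/seteqP; split=> y [sy Cy]; split => //.
    exact: interior_subset.
  apply: contrapT => nCy; have bdy : boundary C y by split => //; exact: subset_closure.
  have [_ /(_ _ bdy)] := hx; rewrite edist_le leNgt => /negP; apply.
  case: sy => t /= /[!in_itv]/= /andP[t0 t1] <-.
  apply: le_lt_trans zx; rewrite addrAC subrr add0r dotZl dotC dotZl mulrA.
  by rewrite ler_piMl ?dot_ge0//; nra.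
move=> /seteqP[_ /(_ z (segment_right p z))] [_ /interior_subset]; exact: nCz.
Qed.

(** A point z of C strictly beyond the line that is orthogonal to px at x would
    see x behind a point of the open disc of radius |px|, making x interior. *)
Lemma nearest_support z : C z -> dot (z - p) (x - p) <= dot (x - p) (x - p).
Proof.
move=> Cz; rewrite leNgt; apply/negP => hz.
pose m := dot (z - x) (x - p); pose n := dot (z - x) (z - x); pose l := m / n.
have m0 : 0 < m.
  have -> : m = dot (z - p) (x - p) - dot (x - p) (x - p).
    by rewrite /m /dot !mxE; ring.
  by rewrite subr_gt0.
have n0 : 0 < n.
  apply: dot_gt0; apply: contraTneq m0 => h; rewrite /m h.
  by rewrite /dot !mxE !mul0r addr0 ltxx.
have l0 : 0 < l by rewrite divr_gt0.
(* l minimizes the distance from p to the point x - l (z - x). *)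
have ia : interior C (x - l *: (z - x)).
  rewrite /interior; apply: (@filterS _ _ (@nbhs_filter 'rV[R]_2 _) _ _ disc_sub).
  apply: open_nbhs_nbhs; split; first exact: open_disc.
  have e : dot (x - l *: (z - x) - p) (x - l *: (z - x) - p) =
      dot (x - p) (x - p) - m * l.
    have -> : dot (x - l *: (z - x) - p) (x - l *: (z - x) - p) =
        dot (x - p) (x - p) - 2 * l * m + l * (l * n).
      by rewrite /m /n /dot !mxE; ring.
    have -> : l * n = m by rewrite /l divfK// gt_eqF.
    by ring.
  by rewrite /= e ltrBlDr ltrDl mulr_gt0.
have [[_ +] _] := hx; apply.
have -> : x = (x - l *: (z - x)) + (l / (1 + l)) *: (z - (x - l *: (z - x))).
  have : 1 + l != 0 by rewrite gt_eqF// addr_gt0.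
  by move=> h; apply: row2P; rewrite !mxE; field.
apply: interior_segment => //; first by rewrite divr_ge0// ?ltW// addr_gt0.
by rewrite ltr_pdivrMr ?addr_gt0// mul1r ltrDr.
Qed.

End Nearest.

(** * The pieces are sectors *)

Section Pieces.
Variable R : realType.
Implicit Types (a b p q u v w z : 'rV[R]_2) (t : R) (i j : nat).

Definition sector k p u i : set 'rV[R]_2 :=
  [set z | 0 <= cross (spoke k u i) (z - p) /\ 0 <= cross (z - p) (spoke k u i.+1)].

Definition open_sector k p u i : set 'rV[R]_2 :=
  [set z | 0 < cross (spoke k u i) (z - p) /\ 0 < cross (z - p) (spoke k u i.+1)].

Lemma open_sector_sub k p u i : open_sector k p u i `<=` sector k p u i.
Proof. by move=> z [/ltW ? /ltW ?]. Qed.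

Lemma open_sector_open k p u i : open (open_sector k p u i).
Proof.
have -> : open_sector k p u i =
    (fun z => cross (z - p) (spoke k u i)) @^-1` [set x | x < 0] `&`
    (fun z => cross (z - p) (spoke k u i.+1)) @^-1` [set x | x > 0].
  by apply/seteqP; split=> z [h1 h2]; split => //; move: h1; rewrite /= cross_gt0C.
apply: openI; apply: open_comp; do ?[by move=> ? _; exact: continuous_cross].
  exact: open_lt.
exact: open_gt.
Qed.

Lemma sector_closed k p u i : closed (sector k p u i).
Proof.
have -> : sector k p u i =
    (fun z => cross (z - p) (spoke k u i)) @^-1` [set x | x <= 0] `&`
    (fun z => cross (z - p) (spoke k u i.+1)) @^-1` [set x | x >= 0].
  by apply/seteqP; split=> z [h1 h2]; split => //; move: h1; rewrite /= cross_ge0C.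
apply: closedI; apply: closed_comp; do ?[by move=> ? _; exact: continuous_cross].
  exact: closed_le.
exact: closed_ge.
Qed.

Lemma crossD_segment a b p v t :
  cross (a + t *: (b - a) - p) v = (1 - t) * cross (a - p) v + t * cross (b - p) v.
Proof. by rewrite /cross !mxE; ring. Qed.

Lemma open_sector_segment k p u i a b t : sector k p u i a -> open_sector k p u i b ->
  0 < t -> t <= 1 -> open_sector k p u i (a + t *: (b - a)).
Proof.
move=> [a1 a2] [b1 b2] t0 t1; rewrite /open_sector/=; split; last first.
  by rewrite crossD_segment; nra.
move: a1 b1; rewrite cross_ge0C !cross_gt0C crossD_segment => a1 b1.
nra.
Qed.

Variables (C : set 'rV[R]_2) (p x : 'rV[R]_2) (k : nat).
Hypotheses (hC : planar_convex_body C) (k2 : (2 < k)%N).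
Hypotheses (hp : symmetry_center k C p) (hx : nearest_boundary_point C p x).

Let u := x - p.
Let S := sector k p u.
Let OS := open_sector k p u.

Let k0 : (0 < k)%N. Proof. by apply: leq_trans k2. Qed.

Let cC : convex_set C. Proof. by case: hC. Qed.

Let clC : closed C.
Proof. by apply: compact_closed; [exact: norm_hausdorff|case: hC]. Qed.

Let ip : interior C p. Proof. by apply: center_interior hp => //; exact: ltnW. Qed.

Let Cp : C p. Proof. by case: hp. Qed.

Let u_gt0 : 0 < dot u u. Proof. exact/dot_gt0/(nearest_neq ip hx). Qed.

Lemma spoke_cross i : 0 < cross (spoke k u i) (spoke k u i.+1).
Proof.
rewrite cross_rot_rot turnS addrK mulr_gt0//; exact: sin_turn_gt0.
Qed.

Lemma spoke_mem i : C (p + spoke k u i).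
Proof. exact: (symmetry_mem i hp (nearest_mem clC hx)). Qed.

Lemma spoke_support i z : C z -> dot (z - p) (spoke k u i) <= dot u u.
Proof.
move=> Cz; have [z' Cz' ->] := symmetry_preimage i hp Cz.
rewrite dot_rot; exact: (nearest_support clC cC ip hx).
Qed.

Definition slit : set 'rV[R]_2 := C `\` \bigcup_(i in `I_k)
  segment p (rotation p (2 * pi * i%:R / k%:R) x).

(** The segment from p to a nearest boundary point is all of the ray in C. *)
Lemma slit_off_ray z i l : slit z -> 0 <= l -> z - p <> l *: spoke k u i.
Proof.
move=> [Cz nz] l0 e; apply: nz; exists (i %% k)%N; first exact: ltn_pmod.
exists l; last first.
  have -> : rotation p (2 * pi * (i %% k)%:R / k%:R) x = p + spoke k u (i %% k) by [].
  by rewrite -spoke_mod// addrAC subrr add0r -e subrKC.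
rewrite /= in_itv/= l0/=; have := spoke_support i Cz.
by rewrite e dotZl dot_spoke -[leRHS]mul1r ler_pM2r.
Qed.

(** Cramer's rule places the points of a closed sector that are not in the open
    one on the two bounding rays. *)
Lemma slit_sector z i : slit z -> S i z -> OS i z.
Proof.
move=> sz [h1 h2]; have c0 := spoke_cross i.
have := @cramer _ _ _ (z - p) (lt0r_neq0 c0).
have d0 : 0 <= (cross (spoke k u i) (spoke k u i.+1))^-1 by rewrite invr_ge0 ltW.
split; rewrite lt_neqAle ?h1 ?h2 andbT eq_sym; apply/eqP => e; move: H; rewrite e.
  rewrite mul0r scale0r addr0; apply: slit_off_ray => //; exact: mulr_ge0.
rewrite mul0r scale0r add0r; apply: slit_off_ray => //; exact: mulr_ge0.
Qed.

Lemma open_sector_off_spokes z i j : (i < k)%N -> OS i z ->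
  ~ segment p (rotation p (2 * pi * j%:R / k%:R) x) z.
Proof.
move=> ik [z1 z2] [l + e]; rewrite /= in_itv/= => /andP[l0 _].
have e' : z - p = l *: spoke k u (j %% k).
  rewrite -e addrAC subrr add0r -spoke_mod//.
  have -> : rotation p (2 * pi * j%:R / k%:R) x = p + spoke k u j by [].
  by rewrite addrAC subrr add0r.
move: z1 z2; rewrite e' crossZr crossZl !cross_rot_rot.
have [->|ln0] := eqVneq l 0; first by rewrite !mul0r ltxx.
have lp : 0 < l by rewrite lt_neqAle eq_sym ln0.
rewrite !(pmulr_rgt0 _ lp) !(pmulr_lgt0 _ u_gt0) => /(spoke_gap ik (ltn_pmod _ k0)).
by rewrite leNgt => /negP.
Qed.

Lemma open_sector_slit z i : (i < k)%N -> C z -> OS i z -> slit z.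
Proof.
by move=> ik Cz oz; split=> // -[j _ h]; exact: (open_sector_off_spokes ik oz h).
Qed.

(** Inside the slit body an open sector is also closed, since its boundary rays
    have been removed. *)
Lemma component_sub z i : (i < k)%N -> slit z -> OS i z ->
  connected_component slit z `<=` OS i.
Proof.
move=> ik sz oz; set K := connected_component slit z.
suff -> : K = K `&` OS i by move=> ? [].
apply/esym/(@component_connected _ slit z).
- by exists z; split => //; exact: connected_component_refl.
- by exists (OS i) => //; exact: open_sector_open.
- exists (S i); first exact: sector_closed.
  apply/seteqP; split=> y [Ky Sy]; split => //; first exact: open_sector_sub.
  by apply: slit_sector Sy; exact: connected_component_sub Ky.
Qed.

(** For the inclusion of the closed sector, the segment from the base point z to
    a point of the sector stays in the open sector until its very end. *)
Lemma piece_sector z i : (i < k)%N -> slit z -> OS i z ->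
  closure (connected_component slit z) = C `&` S i.
Proof.
move=> ik sz oz; apply/seteqP; split.
  have clS : closed (C `&` S i) by apply: closedI; [exact: clC|exact: sector_closed].
  rewrite [X in _ `<=` X]((closure_id _).1 clS).
  apply: closureS => y Ky; split; first by have [] := connected_component_sub Ky.
  exact/open_sector_sub/(component_sub ik sz oz).
move=> y [Cy Sy]; apply: (@closure_segment_end _ _ _ z) => t t0 t1.
have Cz : C z by case: sz.
have Cyz s : 0 <= s -> s <= 1 -> C (y + s *: (z - y)) by exact: convex_segment.
apply: (@connected_component_max _ slit (segment (y + t *: (z - y)) z)).
- exact: segment_right.
- move=> _ [s /= /[!in_itv]/= /andP[s0 s1] <-].
  have -> : y + t *: (z - y) + s *: (z - (y + t *: (z - y))) =
      y + (t + s - s * t) *: (z - y) by apply: row2P; rewrite !mxE; ring.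
  apply: (open_sector_slit ik); first by apply: Cyz; nra.
  by apply: open_sector_segment => //; nra.
- exact: segment_is_connected.
- exact: segment_left.
Qed.

Lemma open_sector_mem i : exists2 z, C z & OS i z.
Proof.
pose a := p + spoke k u i; pose b := p + spoke k u i.+1.
(* The middle of the segment from p to the middle of the chord. *)
exists (p + 2^-1 *: ((a + 2^-1 *: (b - a)) - p)).
  have h0 : 0 <= 2^-1 :> R by lra.
  have h1 : 2^-1 <= 1 :> R by lra.
  by apply: convex_segment => //; apply: convex_segment => //; exact: spoke_mem.
have -> : p + 2^-1 *: ((a + 2^-1 *: (b - a)) - p) =
    p + 4^-1 *: (spoke k u i + spoke k u i.+1).
  by apply: row2P; rewrite !mxE; field.
rewrite /OS /open_sector/= addrAC subrr add0r crossZr crossZl crossDr crossDl !crossvv.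
by rewrite add0r addr0 mulr_gt0//; exact: spoke_cross.
Qed.

Lemma piecesE : pieces k C p x = [set C `&` S i | i in `I_k].
Proof.
apply/seteqP; split=> [_ [z sz <-]|_ [i ik <-]].
  have Cz : C z by case: sz.
  have [i [ik h1 h2]] := sector_cover u (z - p) (ltnW k2).
  exists i => //; apply/esym/piece_sector => //; exact: slit_sector.
have [z Cz oz] := open_sector_mem i.
exists z; first exact: (open_sector_slit ik).
exact/piece_sector/oz/(open_sector_slit ik).
Qed.

End Pieces.

(** * Diameters of sectors *)

Section Cosines.
Variable R : realType.

Lemma cos_turn_mono k l : (1 < k)%N -> (k <= l)%N ->
  cos (turn R k 1) <= cos (turn R l 1).
Proof.
move=> k1 kl; have k0 : (0 < k)%N by exact: ltnW.
have l0 : (0 < l)%N by exact: leq_trans kl.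
have in_pi n : (0 < n)%N -> (1 < n)%N -> turn R n 1 \in `[0, pi].
  by move=> n0 n1; rewrite in_itv/= ltW ?turn_gt0//= turn_le_pi.
rewrite leNgt ltr_cos ?in_pi//; last exact: leq_trans kl.
rewrite -leNgt /turn ler_pM2l ?mulr_gt0 ?mulr1 ?pi_gt0//.
by rewrite lef_pV2 ?posrE ?ltr0n// ler_nat.
Qed.

(** Doubling a fifth of a turn twice gives its opposite, so its cosine c is a
    root of (c - 1) (2 c + 1) (4 c^2 + 2 c - 1). *)
Lemma cos_turn5_lt : cos (turn R 5 1) < 3^-1.
Proof.
have e4 : cos (turn R 5 4) = cos (turn R 5 1).
  rewrite -[RHS]cosN -[RHS]cosD2pi; congr cos.
  by rewrite -[pi *+ 2]mulr_natl -(@turn_full R 5)// (turnD _ _ 1 4); ring.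
have dbl i : cos (turn R 5 (i + i)%N) = cos (turn R 5 i) ^+ 2 *+ 2 - 1.
  by rewrite turnD -mulr2n cos_mulr2n.
move: e4; rewrite (dbl 2) (dbl 1); have := cos_turn_lt1 R (isT : (1 < 5)%N).
move: (cos _) => c c1 e; rewrite ltNge; apply/negP => c3.
have e0 : (1 - c) * (2 * c + 1) * (4 * c ^+ 2 + 2 * c - 1) = 0.
  transitivity (c - ((c ^+ 2 *+ 2 - 1) ^+ 2 *+ 2 - 1)); first by ring.
  by rewrite e subrr.
have : 0 < (1 - c) * (2 * c + 1) * (4 * c ^+ 2 + 2 * c - 1).
  by rewrite !mulr_gt0//; nra.
by rewrite e0 ltxx.
Qed.

(** Doubling a sixth of a turn gives its supplement. *)
Lemma cos_turn6 : cos (turn R 6 1) = 2^-1.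
Proof.
have c0 : 0 <= cos (turn R 6 1).
  apply: cos_ge0_pihalf; have := pi_gt0 R; rewrite /turn => h; apply/andP; split; lra.
have : cos (turn R 6 (1 + 1)%N) = - cos (turn R 6 1).
  rewrite -[in RHS]cosN -cosDpi; congr cos; rewrite /turn; by field.
rewrite turnD -mulr2n cos_mulr2n; move: (cos _) c0 => c c0 e.
have : (c - 2^-1) * (c + 1) = 0.
  by transitivity ((c ^+ 2 *+ 2 - 1 + c) / 2); [field|rewrite e addNr mul0r].
by move=> /eqP; rewrite mulf_eq0 => /orP[]/eqP; lra.
Qed.

End Cosines.

Section Diameters.
Variable R : realType.
Implicit Types (a b p q u v w z : 'rV[R]_2) (S C : set 'rV[R]_2).

Lemma edistC a b : edist a b = edist b a.
Proof.
apply/eqP; rewrite eq_le !edist_le !dotBB.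
by apply/andP; split; rewrite (dotC a b); lra.
Qed.

Lemma diameter_le S M : S !=set0 -> (forall a b, S a -> S b -> edist a b <= M) ->
  diameter S <= M.
Proof.
move=> [z Sz] h; apply: ge_sup; first by exists (edist z z); exists (z, z).
by move=> _ [[a b] /= [Sa Sb] <-]; exact: h.
Qed.

Lemma le_diameter S M a b : (forall a b, S a -> S b -> edist a b <= M) ->
  S a -> S b -> edist a b <= diameter S.
Proof.
move=> h Sa Sb; apply: ub_le_sup; last by exists (a, b).
by exists M => _ [[a' b'] /= [? ?] <-]; exact: h.
Qed.

Definition farthest C p : R := sup [set edist p z | z in C].

Lemma le_farthest C p z : compact C -> C z -> edist p z <= farthest C p.
Proof.
move=> cC Cz; apply: ub_le_sup; last by exists z.
have [M hM] := compact_sqdist_bounded p cC.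
exists (Num.sqrt M) => _ [y Cy <-]; rewrite edistC edistE.
exact/ler_wsqrtr/hM.
Qed.

Lemma farthest_ge0 C p : compact C -> C p -> 0 <= farthest C p.
Proof.
by move=> cC Cp; apply: le_trans (le_farthest p cC Cp); rewrite edistE sqrtr_ge0.
Qed.

(** Opposite an angle at most a sixth of a turn there is never the strictly
    longest side of a triangle: as cos >= 1/2 there, 2 a . b >= |a| |b|. The
    hypotheses say that a and b lie in the cone of u and v, whose opening is
    at most a sixth of a turn; this gives |a x b|^2 <= 3 (a . b)^2 in
    coordinates along u and v, and Lagrange's identity
    |a|^2 |b|^2 = (a . b)^2 + |a x b|^2 turns it into the bound on a . b. *)
Lemma cone_sqdist_le_max u v a b : dot u u = dot v v -> 0 < cross u v ->
  dot u u <= 2 * dot u v ->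
  0 <= cross u a -> 0 <= cross a v -> 0 <= cross u b -> 0 <= cross b v ->
  dot (a - b) (a - b) <= Num.max (dot a a) (dot b b).
Proof.
move=> uv K0 U2c a1 a2 b1 b2; set U := dot u u in uv U2c; set c := dot u v in U2c.
set K := cross u v in K0.
have [s [t [ea s0 t0]]] := cone_coord K0 a1 a2.
have [s' [t' [eb s0' t0']]] := cone_coord K0 b1 b2.
have U0 : 0 <= U by exact: dot_ge0.
have UK : K ^+ 2 + c ^+ 2 = U ^+ 2.
  by rewrite [RHS]expr2 {2}uv /K /c /U /cross /dot; ring.
have eP : dot a b = U * (s * s' + t * t') + c * (s * t' + t * s').
  transitivity (s * s' * U + t * t' * dot v v + c * (s * t' + t * s')); last by rewrite -uv; ring.
  by rewrite ea eb /c /U /dot !mxE; ring.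
have eX : cross a b = K * (s * t' - t * s') by rewrite ea eb /K /cross !mxE; ring.
have lag : dot a a * dot b b = dot a b ^+ 2 + cross a b ^+ 2 by rewrite /dot /cross; ring.
set P := dot a b in eP lag; set X := cross a b in eX lag.
have h1 := mulr_ge0 s0 s0'; have h2 := mulr_ge0 t0 t0'.
have h3 := mulr_ge0 s0 t0'; have h4 := mulr_ge0 t0 s0'.
have c0 : 0 <= c by lra.
have Pge : c * (s * t' + t * s') <= P by rewrite eP lerDr mulr_ge0// addr_ge0.
have Q0 : 0 <= c * (s * t' + t * s') by rewrite mulr_ge0// addr_ge0.
have P0 : 0 <= P by exact: le_trans Pge.
have XP : X ^+ 2 <= 3 * P ^+ 2.
  have hP : (c * (s * t' + t * s')) ^+ 2 <= P ^+ 2 by rewrite ler_sqr.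
  apply: (@le_trans _ _ (3 * (c * (s * t' + t * s')) ^+ 2)); last lra.
  have Kc : K ^+ 2 <= 3 * c ^+ 2.
    have : U ^+ 2 <= (2 * c) ^+ 2 by rewrite ler_sqr ?nnegrE ?mulr_ge0.
    by rewrite -UK (_ : (2 * c) ^+ 2 = 4 * c ^+ 2); [lra|ring].
  rewrite eX !exprMn [leRHS]mulrA; apply: ler_pM; rewrite ?sqr_ge0//.
  have e : (s * t' + t * s') ^+ 2 = (s * t' - t * s') ^+ 2 + 4 * (s * t' * (t * s')) by ring.
  by rewrite e lerDl mulr_ge0// mulr_ge0.
rewrite dotBB -/P.
have := dot_ge0 a; have := dot_ge0 b.
move: (dot a a) (dot b b) lag => A B lag B0 A0.
have [AB|BA] := leP A B.
  suff : A <= 2 * P by lra.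
  by rewrite -ler_sqr ?nnegrE ?mulr_ge0//; nra.
suff : B <= 2 * P by lra.
by rewrite -ler_sqr ?nnegrE ?mulr_ge0//; nra.
Qed.

Variables (C : set 'rV[R]_2) (p x : 'rV[R]_2) (k : nat).
Hypotheses (hC : planar_convex_body C) (k2 : (2 < k)%N).
Hypotheses (hp : symmetry_center k C p) (hx : nearest_boundary_point C p x).

Let u := x - p.
Let S := sector k p u.
Let D := max_rel_diameter (pieces k C p x).

Let k0 : (0 < k)%N. Proof. by apply: leq_trans k2. Qed.

Let comC : compact C. Proof. by case: hC. Qed.

Lemma center_in_sector i : S i p.
Proof. by rewrite /S /sector/= /cross subrr !mxE !mulr0 !mul0r subr0. Qed.

Let piece_neq0 i : C `&` S i !=set0.
Proof. by exists p; split; [case: hp|exact: center_in_sector]. Qed.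

Lemma max_rel_diameter_le M :
  (forall i a b, (i < k)%N -> C a -> C b -> S i a -> S i b -> edist a b <= M) ->
  D <= M.
Proof.
move=> h; rewrite /D /max_rel_diameter piecesE//; apply: ge_sup.
  by exists (diameter (C `&` S 0)); exists (C `&` S 0) => //; exists 0%N.
move=> _ [_ [i ik <-] <-]; apply: diameter_le => // a b [Ca Sa] [Cb Sb].
exact: h Sa Sb.
Qed.

Lemma le_max_rel_diameter i a b : (i < k)%N -> C a -> C b -> S i a -> S i b ->
  edist a b <= D.
Proof.
move=> ik Ca Cb Sa Sb; have [M hM] := compact_sqdist_bounded p comC.
have bdd z y : C z -> C y -> edist z y <= Num.sqrt (4 * M).
  move=> Cz Cy; rewrite edistE; apply: ler_wsqrtr.
  have := hM _ Cz; have := hM _ Cy; have := dot_ge0 ((z - p) + (y - p)).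
  by rewrite /dot !mxE; nra.
rewrite /D /max_rel_diameter piecesE//.
apply: (@le_trans _ _ (diameter (C `&` S i))).
  by apply: (@le_diameter _ (Num.sqrt (4 * M))) => // z y [Cz _] [Cy _]; exact: bdd.
apply: ub_le_sup; last by exists (C `&` S i) => //; exists i.
exists (Num.sqrt (4 * M)) => _ [_ [j jk <-] <-].
by apply: diameter_le => // z y [Cz _] [Cy _]; exact: bdd.
Qed.

(** Every point of C shares a piece with p. *)
Lemma farthest_le_max_rel_diameter : farthest C p <= D.
Proof.
apply: ge_sup; first by exists (edist p p); exists p => //; case: hp.
move=> _ [z Cz <-]; have [i [ik h1 h2]] := sector_cover u (z - p) (ltnW k2).
by apply: (@le_max_rel_diameter i) => //; [case: hp|exact: center_in_sector].
Qed.

Lemma max_rel_diameter_farthest : (6 <= k)%N -> D = farthest C p.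
Proof.
move=> k6; apply/eqP; rewrite eq_le farthest_le_max_rel_diameter andbT.
apply: max_rel_diameter_le => i a b ik Ca Cb [a1 a2] [b1 b2].
have : dot (a - p - (b - p)) (a - p - (b - p)) <=
    Num.max (dot (a - p) (a - p)) (dot (b - p) (b - p)).
  apply: cone_sqdist_le_max a1 a2 b1 b2; first by rewrite !dot_spoke.
    exact: (spoke_cross hC k2 hp hx).
  rewrite dot_spoke dot_rot_rot turnS addrK mulrA ler_peMl ?dot_ge0//.
  by have := cos_turn_mono R (isT : (1 < 6)%N) k6; rewrite cos_turn6; lra.
rewrite opprB addrA subrK => h; rewrite edistC.
have : edist b a <= edist p a \/ edist b a <= edist p b.
  rewrite !edist_le; move: h; rewrite le_max => /orP[]; by [left|right].
by case=> /le_trans; apply; exact: le_farthest.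
Qed.

(** The feet of two consecutive spokes belong to a common piece. *)
Lemma chord_le_max_rel_diameter :
  (2 - 2 * cos (turn R k 1)) * dot u u <= D ^+ 2.
Proof.
have c0 : 0 < cross (spoke k u 0) (spoke k u 1) by exact: (spoke_cross hC k2 hp hx).
have : edist (p + spoke k u 0) (p + spoke k u 1) <= D.
  apply: (@le_max_rel_diameter 0); rewrite ?k0//; do ?exact: (spoke_mem hC hp hx).
    by split; rewrite addrAC subrr add0r ?crossvv// ltW.
  by split; rewrite addrAC subrr add0r ?crossvv// ltW.
rewrite -ler_sqr ?nnegrE; last 2 first.
  by rewrite edistE sqrtr_ge0.
  by apply: le_trans farthest_le_max_rel_diameter; apply: farthest_ge0 => //; case: hp.
apply: le_trans; rewrite edistE sqr_sqrtr ?dot_ge0//.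
have -> : p + spoke k u 0 - (p + spoke k u 1) = spoke k u 0 - spoke k u 1.
  by rewrite opprD addrACA subrr add0r.
by rewrite dotBB !dot_spoke dot_rot_rot turn0 subr0; lra.
Qed.

(** C lies in the regular k-gon cut out by the supporting lines at the feet of
    the spokes. *)
Lemma sqdist_le z : C z -> (1 + cos (turn R k 1)) * dot (z - p) (z - p) <= 2 * dot u u.
Proof.
move=> Cz; have [i [ik h1 h2]] := sector_cover u (z - p) (ltnW k2).
have K0 : 0 < cross (spoke k u i) (spoke k u i.+1) by exact: (spoke_cross hC k2 hp hx).
have [s [t [ez s0 t0]]] := cone_coord K0 h1 h2.
have w1 : dot (z - p) (spoke k u i) <= dot u u by exact: (spoke_support hC k2 hp hx).
have w2 : dot (z - p) (spoke k u i.+1) <= dot u u by exact: (spoke_support hC k2 hp hx).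
have U0 : 0 < dot u u by exact/dot_gt0/(nearest_neq _ hx)/(center_interior (ltnW k2) hC hp).
have ew : dot (z - p) (z - p) =
    s * dot (z - p) (spoke k u i) + t * dot (z - p) (spoke k u i.+1).
  by rewrite [X in dot X _ = _]ez dot_comb !(dotC (z - p)).
have le1 : dot (z - p) (z - p) <= (s + t) * dot u u.
  by rewrite ew mulrDl lerD// ler_wpM2l.
have c1 := cos_geN1 (turn R k 1).
have e1 : dot (z - p) (spoke k u i) = (s + t * cos (turn R k 1)) * dot u u.
  rewrite ez dot_comb dot_spoke (dotC (spoke k u i.+1)) dot_rot_rot turnS addrK.
  by ring.
have e2 : dot (z - p) (spoke k u i.+1) = (s * cos (turn R k 1) + t) * dot u u.
  by rewrite ez dot_comb dot_spoke dot_rot_rot turnS addrK; ring.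
have le2 : (1 + cos (turn R k 1)) * (s + t) * dot u u <= 2 * dot u u.
  by move: w1 w2; rewrite e1 e2; lra.
apply: le_trans le2; rewrite -mulrA ler_wpM2l//; lra.
Qed.

End Diameters.

(** * Comparison of two partitions *)

Section Comparison.
Variable R : realType.
Implicit Types (p x y : 'rV[R]_2) (C : set 'rV[R]_2) (k l : nat).

(** In units of the inradius, the value 4/3 separates the squares of the two
    diameters: cos (2 pi / k) < 1/3 makes the chord longer for k <= 5, and
    cos (2 pi / l) >= 1/2 makes the circumradius at most that for l >= 6. *)
Lemma max_rel_diameter_lt C p x y k l : planar_convex_body C ->
  (2 < k)%N -> (k <= 5)%N -> (6 <= l)%N ->
  symmetry_center k C p -> symmetry_center l C p ->
  nearest_boundary_point C p x -> nearest_boundary_point C p y ->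
  max_rel_diameter (pieces l C p y) < max_rel_diameter (pieces k C p x).
Proof.
move=> hC k2 k5 l6 hk hl hx hy; have l2 : (2 < l)%N by exact: leq_trans l6.
have cC : compact C by case: hC.
have Cp : C p by case: hk.
rewrite (max_rel_diameter_farthest hC l2 hl hy l6).
have r0 : 0 < dot (x - p) (x - p).
  exact/dot_gt0/(nearest_neq _ hx)/(center_interior (ltnW k2) hC hk).
have rxy : dot (y - p) (y - p) = dot (x - p) (x - p).
  have [[bx nx] [by_ ny]] := (hx, hy).
  by apply/eqP; rewrite eq_le -!edist_le nx// ny.
have F2 : farthest C p <= Num.sqrt (4 / 3 * dot (x - p) (x - p)).
  apply: ge_sup; first by exists (edist p p); exists p => //; case: hk.
  move=> _ [z Cz <-]; rewrite edistC edistE ler_wsqrtr//.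
  have := sqdist_le hC l2 hl hy Cz; rewrite rxy.
  have := cos_turn_mono R (isT : (1 < 6)%N) l6; rewrite cos_turn6.
  by have := dot_ge0 (z - p); nra.
apply: le_lt_trans F2 _.
have := chord_le_max_rel_diameter hC k2 hk hx.
have := cos_turn_mono R (ltnW k2) k5; have := cos_turn5_lt R.
move: (cos _) (cos _) => c5 c h5 h D2.
rewrite -[ltRHS]ger0_norm; last first.
  exact: le_trans (farthest_ge0 cC Cp) (farthest_le_max_rel_diameter hC k2 hk hx).
rewrite -sqrtr_sqr ltr_sqrt; first by nra.
by apply: lt_le_trans D2; nra.
Qed.

End Comparison.

(** * Degrees of symmetry *)

Section Degrees.
Variable R : realType.
Implicit Types (p x y : 'rV[R]_2) (C : set 'rV[R]_2) (k l : nat).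

(** By Bezout's identity the rotation by 1/lcm of a turn is a combination of the
    rotations by 1/k and 1/l of a turn. *)
Lemma symmetry_center_lcm C p k l : (0 < k)%N -> (0 < l)%N ->
  symmetry_center k C p -> symmetry_center l C p -> symmetry_center (lcmn k l) C p.
Proof.
move=> k0 l0 hk hl; split; first by case: hk.
have [a _ /dvdnP[c ec]] := Bezoutl l k0.
have eturn : turn R (lcmn k l) 1 + turn R k a = turn R l c.
  have L0 : (0 < lcmn k l)%N by rewrite lcmn_gt0 k0.
  have g0 : (0 < gcdn k l)%N by rewrite gcdn_gt0 k0.
  have eL := muln_lcm_gcd k l.
  rewrite /turn; move: ec eL => /(congr1 (fun n => n%:R : R)) + /(congr1 (fun n => n%:R : R)).
  rewrite natrD !natrM; move: L0 g0 k0 l0; rewrite -!(ltr0n R).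
  move: (lcmn k l)%:R (gcdn k l)%:R (k%:R) (l%:R) (a%:R) (c%:R) => L g k' l' a' c'.
  move=> L0 g0 k0' l0' ec eL.
  have -> : L = k' * l' / g by rewrite -eL mulfK// gt_eqF.
  have -> : c' = (g + a' * l') / k' by rewrite ec mulfK// gt_eqF.
  by field; rewrite !gt_eqF.
rewrite -turn1; apply/seteqP; split=> [_ [z Cz <-]|z Cz].
  have [z' Cz' e] := symmetry_preimage a hk Cz.
  by rewrite rotationE e rot_rot eturn; exact: (symmetry_mem c hl Cz').
have [z' Cz' e] := symmetry_preimage c hl Cz.
exists (p + rot (turn R k a) (z' - p)); first exact: (symmetry_mem a hk Cz').
by rewrite rotationE addrAC subrr add0r rot_rot eturn -e subrKC.
Qed.

(** The least common multiple of the two degrees is again a degree, so it cannot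
    exceed the maximal one. *)
Lemma degree_dvd C k kC : planar_convex_body C -> maximal_degree C kC ->
  rotationally_symmetric k C -> (k %| kC)%N.
Proof.
move=> [cC _ _] [[kC2 [p hp]] hmax] [k2 [q hq]].
have qp := center_unique k2 kC2 cC hq hp; rewrite qp in hq.
have k0 := ltnW k2; have kC0 := ltnW kC2.
have L : (lcmn k kC <= kC)%N.
  apply: hmax; split; last by exists p; exact: symmetry_center_lcm.
  by apply: leq_trans kC2 _; rewrite dvdn_leq ?dvdn_lcmr// lcmn_gt0 k0.
have -> : kC = lcmn k kC.
  by apply/eqP; rewrite eqn_leq L dvdn_leq ?dvdn_lcmr// lcmn_gt0 k0.
exact: dvdn_lcml.
Qed.

Lemma maximal_degree_not_prime C kC : planar_convex_body C ->
  multi_rotationally_symmetric C -> maximal_degree C kC -> ~ prime kC.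
Proof.
move=> hC [k [l [kl hk hl]]] hmax /primeP[_ pr]; apply: kl.
have eq m : rotationally_symmetric m C -> m = kC.
  move=> hm; have /pr := degree_dvd hC hmax hm.
  by case: hm => m2 _ /orP[/eqP m1|/eqP//]; rewrite m1 in m2.
by rewrite (eq k)// (eq l).
Qed.

End Degrees.

Lemma prime_factors n : (0 < n)%N -> exists s : seq nat,
  (forall q, q \in s -> prime q /\ (q %| n)%N) /\ n = (\prod_(q <- s) q)%N.
Proof.
elim/ltn_ind: n => n IH n0; have [n1|n1] := leqP n 1.
  by exists [::]; rewrite big_nil; split => //; lia.
have pn := pdiv_prime n1; have dn := pdiv_dvd n.
have nd : (n %/ pdiv n < n)%N by rewrite ltn_Pdiv// prime_gt1.
have d0 : (0 < n %/ pdiv n)%N by rewrite divn_gt0 ?pdiv_gt0// dvdn_leq.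
have [s [hs es]] := IH _ nd d0.
exists (pdiv n :: s); rewrite big_cons -es mulnC divnK//; split=> // q.
rewrite inE => /orP[/eqP->//|/hs[pq qn]]; split=> //.
by apply: dvdn_trans qn (dvdn_div dn).
Qed.

Lemma prime_dvd_prod (q : nat) (s : seq nat) : prime q ->
  (forall p, p \in s -> prime p) -> (q %| \prod_(p <- s) p)%N -> q \in s.
Proof.
move=> pq hs; rewrite Euclid_dvd_prod// big_has => /hasP[p ps].
by rewrite dvdn_prime2// ?hs// => /eqP->.
Qed.

(** * The chain of equalities *)

Theorem theorem3p9 (R : realType) (C : set 'rV[R]_2) (kC chiC : nat)
    (ks : seq nat) (P : nat -> set (set 'rV[R]_2))
    (hC : planar_convex_body C)
    (hmulti : multi_rotationally_symmetric C)
    (hkC : maximal_degree C kC)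
    (hchiC : minimal_degree C chiC)
    (hchiC3 : (3 <= chiC)%N)
    (hks_sorted : sorted ltn ks)
    (hks : forall d : nat, d \in ks <-> (d %| kC)%N /\ (1 < d)%N)
    (hP : forall i : nat, (i < size ks)%N ->
            standard_partition (nth 0%N ks i) C (P i)) :
  (forall i : nat, (i.+1 < size ks)%N ->
     max_rel_diameter (P i) = max_rel_diameter (P i.+1))
  <->
  (exists s : seq nat,
     (forall q : nat, q \in s -> prime q /\ (7 <= q)%N) /\
     kC = (\prod_(q <- s) q)%N).
Proof.
have cC : compact C by case: hC.
have [[kC2 [p hp]] _] := hkC.
have part i : (i < size ks)%N -> exists x, [/\ (2 < nth 0%N ks i)%N,
    symmetry_center (nth 0%N ks i) C p, nearest_boundary_point C p x
    & P i = pieces (nth 0%N ks i) C p x].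
  move=> ik; have [q [x [hq hx ->]]] := hP i ik.
  have [_ d1] := (hks _).1 (mem_nth 0%N ik).
  have qp := center_unique d1 kC2 cC hq hp; rewrite qp in hq hx *.
  exists x; split => //; apply: leq_trans hchiC3 _.
  by apply: hchiC.2; split => //; exists p.
split=> [chain|[s [hs kCs]] i iks].
  have all_eq i : (i < size ks)%N -> max_rel_diameter (P i) = max_rel_diameter (P 0%N).
    by elim: i => // i IH iks; rewrite -chain// IH// ltnW.
  have [s [hs es]] := prime_factors (ltnW kC2).
  exists s; split=> // q /hs[pq qkC]; split=> //.
  rewrite leqNgt; apply/negP => q7.
  have qks : q \in ks by apply/hks; split=> //; exact: prime_gt1.
  have kks : kC \in ks by apply/hks.
  have [x [q2 hq hx Pq]] := part _ (etrans (index_mem _ _) qks).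
  have [y [_ _ hy PkC]] := part _ (etrans (index_mem _ _) kks).
  rewrite !nth_index// in q2 hq Pq PkC.
  have q5 : (q <= 5)%N by case: q pq q7 {qkC qks hx hq q2 Pq} => [|[|[|[|[|[|[|]]]]]]].
  have kC6 : (6 <= kC)%N.
    case/dvdnP: qkC => m em; have : m <> 1%N.
      move=> m1; apply: (maximal_degree_not_prime hC hmulti hkC).
      by rewrite em m1 mul1n.
    by nia.
  have := max_rel_diameter_lt hC q2 q5 kC6 hq hp hx hy.
  by rewrite -Pq -PkC !all_eq ?index_mem// ltxx.
have far j : (j < size ks)%N -> max_rel_diameter (P j) = farthest C p.
  move=> jk; have [x [d2 hd hx ->]] := part j jk.
  apply: max_rel_diameter_farthest => //.
  have [dk d1] := (hks _).1 (mem_nth 0%N jk).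
  have : pdiv (nth 0%N ks j) \in s.
    apply: prime_dvd_prod; first exact: pdiv_prime.
      by move=> q /hs[].
    by rewrite -kCs; apply: dvdn_trans dk; exact: pdiv_dvd.
  by move=> /hs[_ /ltnW /leq_trans]; apply; rewrite dvdn_leq ?pdiv_dvd// ltnW.
by rewrite !far// ltnW.
Qed.
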